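(* Let $X$ be a real Banach space with $\dim X\ge 2$ and let $M:X^*\to X^*$ be a mapping such that: (i) $M$ is one-to-one and onto; (ii) for every $x\in X$, both functions $\langle M(\cdot),x\rangle:X^*\to\mathbb{R}$ and $\langle M^{-1}(\cdot),x\rangle:X^*\to\mathbb{R}$ are quasiconvex. Then $M$ is affine.
   Context: $X^*$ is the topological dual of $X$ and $\langle u,x\rangle=u(x)$ for $u\in X^*$, $x\in X$. A function $\phi:X^*\to\mathbb{R}$ is quasiconvex if $\phi(su_1+(1-s)u_2)\le\max\{\phi(u_1),\phi(u_2)\}$ for all $u_1,u_2\in X^*$ and all $s\in[0,1]$. $M$ is affine if $M(su_1+(1-s)u_2)=sM(u_1)+(1-s)M(u_2)$ for all $u_1,u_2\in X^*$, $s\in[0,1]$. *)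

(* Defs.v *)
From HB Require Import structures.
From mathcomp Require Export all_boot all_order all_algebra.
From mathcomp Require Export all_classical all_reals all_analysis.

Set Implicit Arguments.
Unset Strict Implicit.
Unset Printing Implicit Defensive.

Import Order.TTheory GRing.Theory Num.Theory.
Import numFieldNormedType.Exports.

Local Open Scope classical_set_scope.
Local Open Scope ring_scope.

Definition continuous_linear (R : realType) (X : normedModType R) :
    {pred X -> R^o} :=
  fun u => `[< linear u /\ continuous u >].

Lemma continuous_linear_submod (R : realType) (X : normedModType R) :
  submod_closed (@continuous_linear R X).
Proof.
split=> [|a u v /asboolP[ul uc] /asboolP[vl vc]]; apply/asboolP; split.
- by move=> k x y /=; rewrite -[LHS]/(0 : R) scaler0 addr0.
- exact: cst_continuous.
- move=> k x y; rewrite -[LHS]/(a *: u (k *: x + y) + v (k *: x + y)).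
  rewrite -[RHS]/(k *: (a *: u x + v x) + (a *: u y + v y)) ul vl.
  by rewrite !scalerDr !scalerA (mulrC a k) addrACA.
- move=> x; apply: (@continuousD _ R^o X (a *: u) v); last exact: vc.
  by apply: cvgZr; exact: uc.
Qed.

HB.instance Definition _ (R : realType) (X : normedModType R) :=
  GRing.isSubmodClosed.Build R (X -> R^o) (@continuous_linear R X)
    (@continuous_linear_submod R X).

(* The dual is a subspace of the pointwise vector space X -> R; its norm and
   topology are not needed. *)
Record dual (R : realType) (X : normedModType R) := Dual {
  dual_fun :> X -> R^o;
  _ : dual_fun \in @continuous_linear R X }.

HB.instance Definition _ (R : realType) (X : normedModType R) :=
  [isSub for @dual_fun R X].
HB.instance Definition _ (R : realType) (X : normedModType R) :=
  [Choice of dual X by <:].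
HB.instance Definition _ (R : realType) (X : normedModType R) :=
  [SubChoice_isSubZmodule of dual X by <:].
HB.instance Definition _ (R : realType) (X : normedModType R) :=
  [SubZmodule_isSubLmodule of dual X by <:].

Definition dim_ge (n : nat) (R : realType) (V : lmodType R) : Prop :=
  exists v : 'I_n -> V, forall a : 'I_n -> R,
    \sum_(i < n) a i *: v i = 0 -> forall i, a i = 0.

Definition quasiconvex (R : realType) (V : lmodType R) (phi : V -> R) : Prop :=
  forall (u1 u2 : V) (s : R), 0 <= s <= 1 ->
    phi (s *: u1 + (1 - s) *: u2) <= Num.max (phi u1) (phi u2).

Definition affine (R : realType) (V W : lmodType R) (M : V -> W) : Prop :=
  forall (u1 u2 : V) (s : R), 0 <= s <= 1 ->
    M (s *: u1 + (1 - s) *: u2) = s *: M u1 + (1 - s) *: M u2.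

(* Main.v *)
From HB Require Import structures.
Require Import Defs.
From mathcomp Require Import all_boot all_order all_algebra.
From mathcomp Require Import all_classical all_reals all_analysis.
From mathcomp Require Import ring lra.
Import Order.TTheory GRing.Theory Num.Theory.
Import numFieldNormedType.Exports.
Local Open Scope ring_scope.
Set Implicit Arguments.
Unset Strict Implicit.
Unset Printing Implicit Defensive.

(* Quasiconvexity at [x] and at [-x] traps <M(su + (1-s)v), x> between <Mu, x>
   and <Mv, x>; as this holds for every [x], M maps segments into segments, and
   so does its inverse. Hence N = M - M(0) maps lines onto lines. If [u], [v]
   are independent, N maps the parallel lines u + Rv and Rv to disjoint lines in
   one plane, so N(u + v) = N u + N v; a third vector extends this to collinear
   [u], [v], for which dim X^* >= 2 is needed (Hahn-Banach). Finally N is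
   additive and maps [0, u] into [0, N u], which forces homogeneity. *)

(** * Sublinear functionals and the Hahn-Banach theorem *)

Definition sublinear (R : realType) (V : lmodType R) (p : V -> R) :=
  (forall x y, p (x + y) <= p x + p y) /\
  (forall (t : R) x, 0 <= t -> p (t *: x) <= t * p x).

(** Common to the two infima below: one over a ray of translates, one over a chain of
    functionals. *)
Lemma sublinear_inf (R : realType) (V : lmodType R) (E : V -> set R) :
  (forall x, E x !=set0)%classic -> (forall x, has_lbound (E x)) ->
  (forall x y a b, E x a -> E y b -> exists2 c, E (x + y) c & c <= a + b) ->
  (forall t x a, 0 <= t -> E x a -> exists2 c, E (t *: x) c & c <= t * a) ->
  sublinear (fun x => inf (E x)).
Proof.
move=> E0 Elb ED EZ; split=> [x y|t x t0].
  rewrite -lerBlDr; apply: lb_le_inf => // a Ea.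
  rewrite lerBlDr -lerBlDl; apply: lb_le_inf => // b Eb.
  rewrite lerBlDl; have [c Ec] := ED _ _ _ _ Ea Eb.
  by apply: le_trans; exact: ge_inf.
have infZ a : E x a -> inf (E (t *: x)) <= t * a.
  move=> /(EZ _ _ _ t0)[c Ec]; apply: le_trans; exact: ge_inf.
have [tE0|tN0] := eqVneq t 0.
  by have [a /infZ] := E0 x; rewrite tE0 !mul0r.
have {}t0 : 0 < t by rewrite lt_def tN0.
rewrite -ler_pdivrMl//; apply: lb_le_inf => // a /infZ.
by rewrite ler_pdivrMl.
Qed.

Lemma sublinear0 (R : realType) (V : lmodType R) (p : V -> R) :
  sublinear p -> p 0 = 0.
Proof.
move=> [pD pZ]; apply: le_anti.
have := pZ 0 0 (lexx _); rewrite scale0r mul0r => ->/=.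
by have := pD 0 0; rewrite addr0 -lerBlDl subrr.
Qed.

Lemma sublinear_opp_le (R : realType) (V : lmodType R) (p : V -> R) (x : V) :
  sublinear p -> - p (- x) <= p x.
Proof.
move=> psub; rewrite lerNl -subr_ge0 opprK addrC -(sublinear0 psub).
by rewrite -(subrr x); exact: psub.1.
Qed.

(* [q x] is the infimum over [t >= 0] of [p (x + t *: y) - t * p y]. *)
Lemma sublinear_decrease (R : realType) (V : lmodType R) (p : V -> R) (y : V) :
  sublinear p -> exists q, sublinear q /\ (forall x, q x <= p x) /\
    q (- y) <= - p y.
Proof.
move=> psub; have [pD pZ] := psub.
(* The converse bound comes from scaling [t *: y] back by the inverse of [t]. With subadditivity it
   bounds [E x] below by [- p (- x)]. *)
have pZ' (t : R) : 0 <= t -> t * p y <= p (t *: y).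
  rewrite le_eqVlt => /predU1P[<-|t0].
    by rewrite scale0r mul0r sublinear0.
  rewrite mulrC -ler_pdivlMr// mulrC.
  rewrite -{1}[y]scale1r -(mulVf (lt0r_neq0 t0)) -scalerA.
  by apply: pZ; rewrite invr_ge0 ltW.
pose E x : set R :=
  [set p (x + t *: y) - t * p y | t in [set t | 0 <= t]]%classic.
have Elb x : has_lbound (E x).
  exists (- p (- x)) => _ [t /= t0 <-].
  rewrite lerBrDr addrC lerBlDr (le_trans (pZ' _ t0))//.
  by apply: le_trans (pD _ _); rewrite addrAC subrr add0r.
exists (fun x => inf (E x)); split; [apply: sublinear_inf => //|split].
- by move=> x; exists (p (x + 0 *: y) - 0 * p y), 0 => /=.
- move=> x z _ _ [t /= t0 <-] [s /= s0 <-].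
  exists (p (x + z + (t + s) *: y) - (t + s) * p y).
    by exists (t + s) => //=; rewrite addr_ge0.
  by rewrite scalerDl (addrACA x) mulrDl opprD [leRHS]addrACA lerD2r pD.
- move=> r x _ r0 [t /= t0 <-].
  exists (p (r *: x + (r * t) *: y) - (r * t) * p y).
    by exists (r * t) => //=; rewrite mulr_ge0.
  by rewrite -scalerA -scalerDr mulrBr mulrA lerD2r pZ.
- move=> x; apply: ge_inf => //; exists 0 => //=.
  by rewrite scale0r mul0r addr0 subr0.
(* At [- y] the parameter 1 gives the value [p 0 - p y]. *)
- apply: ge_inf => //; exists 1 => //=.
  by rewrite scale1r mul1r addNr sublinear0// sub0r.
Qed.

(* A decreasing chain of sublinear functionals is bounded below by
   [- p (- x)], so its infimum is finite and Zorn's lemma applies. *)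
Lemma exists_minimal_sublinear (R : realType) (V : lmodType R) (p : V -> R) :
  sublinear p -> exists q, sublinear q /\ (forall x, q x <= p x) /\
    forall r, sublinear r -> (forall x, r x <= q x) -> r = q.
Proof.
move=> psub.
pose T := {q : V -> R | sublinear q /\ forall x, q x <= p x}.
(* The order is reversed, so that a maximal element is a minimal functional. *)
pose le_T (q r : T) := `[< forall x, sval r x <= sval q x >].
have [| | | |[q [qsub qp]] qmin] := @Zorn T le_T.
- by move=> q; apply/asboolP.
- move=> q r s /asboolP qr /asboolP rs; apply/asboolP => x.
  exact: le_trans (qr x).
- move=> [q qP] [r rP] /asboolP/= qr /asboolP/= rq.
  apply: eq_exist; apply: funext => x.
  by apply: le_anti; rewrite qr rq.
- move=> A Atot; have [[q0 Aq0]|A0] := pselect (exists q, A q); last first.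
    exists (exist _ p (conj psub (fun x => lexx _))) => q Aq.
    by exfalso; apply: A0; exists q.
  pose E x : set R := [set sval q x | q in A]%classic.
  have Elb x : has_lbound (E x).
    exists (- p (- x)) => _ [q Aq <-].
    apply: le_trans (sublinear_opp_le x (svalP q).1).
    by rewrite lerN2 (svalP q).2.
  have isub : sublinear (fun x => inf (E x)).
    apply: sublinear_inf => //.
    + by move=> x; exists (sval q0 x), q0.
    + move=> x y _ _ [q Aq <-] [r Ar <-].
      (* The smaller of two comparable members serves both [x] and [y]. *)
      have [/asboolP qr|/asboolP rq] := Atot _ _ Aq Ar.
        exists (sval r (x + y)); first by exists r.
        by apply: le_trans ((svalP r).1.1 _ _) _; rewrite lerD2r.
      exists (sval q (x + y)); first by exists q.
      by apply: le_trans ((svalP q).1.1 _ _) _; rewrite lerD2l.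
    + move=> t x _ t0 [q Aq <-]; exists (sval q (t *: x)); first by exists q.
      exact: (svalP q).1.2.
  have ip x : inf (E x) <= p x.
    by apply: le_trans (_ : sval q0 x <= _); [apply: ge_inf => //; exists q0|
      exact: (svalP q0).2].
  exists (exist _ (fun x => inf (E x)) (conj isub ip)) => q Aq.
  apply/asboolP => x /=.
  by apply: ge_inf => //; exists q.
- exists q; split=> //; split=> // r rsub rq.
  have rp x : r x <= p x by exact: le_trans (qp x).
  have qr : le_T (exist _ q (conj qsub qp)) (exist _ r (conj rsub rp)).
    exact/asboolP.
  exact: (congr1 sval (qmin _ qr)).
Qed.

(* A minimal sublinear functional [f] equals each [q] provided by
   [sublinear_decrease]; this forces [f (- x) = - f x], hence linearity. *)
Lemma Hahn_Banach (R : realType) (V : lmodType R) (p : V -> R) (y : V) :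
  sublinear p -> exists f : V -> R^o,
    linear f /\ (forall x, f x <= p x) /\ f y = p y.
Proof.
(* Decreasing [p] along [y] first makes every linear [f] below [p'] satisfy [f (- y) <= - p y],
   hence [f y = p y]. *)
move=> /(sublinear_decrease y)[p' [p'sub [p'p p'y]]].
have [f [fsub [fp' fmin]]] := exists_minimal_sublinear p'sub.
have [fD fZ] := fsub.
have fN x : f (- x) = - f x.
  have [q [qsub [qf qx]]] := sublinear_decrease x fsub.
  apply: le_anti; rewrite -{1}(fmin q qsub qf) qx/=.
  by have := sublinear_opp_le (- x) fsub; rewrite opprK.
have fadd x z : f (x + z) = f x + f z.
  apply: le_anti; rewrite fD/= -lerBrDr -fN.
  by rewrite -{1}(addrK z x) fD.
have fscale_ge0 (t : R) x : 0 <= t -> f (t *: x) = t * f x.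
  move=> t0; apply: le_anti; rewrite fZ//=.
  by have := fZ t (- x) t0; rewrite scalerN !fN mulrN lerN2.
exists f; split=> [t x z|]; last split.
- rewrite fadd; congr (_ + _).
  have [t0|t0] := leP 0 t; first exact: fscale_ge0.
  rewrite -[t]opprK scaleNr fN fscale_ge0 ?oppr_ge0 ?ltW//.
  by rewrite -mulNr.
- by move=> x; exact: le_trans (p'p x).
- apply: le_anti; rewrite (le_trans (fp' y) (p'p y))/=.
  by rewrite -lerN2 -fN (le_trans (fp' _)).
Qed.

(** * Bijections that preserve segments in both directions *)

Definition segment_preserving (R : realType) (V W : lmodType R) (N : V -> W) :=
  forall (u v : V) (s : R), 0 <= s <= 1 -> exists t : R,
    0 <= t <= 1 /\ N (s *: u + (1 - s) *: v) = t *: N u + (1 - t) *: N v.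

Lemma segment_preserving_line (R : realType) (V W : lmodType R) (N : V -> W) :
  injective N -> segment_preserving N -> forall u v (s : R),
    exists t : R, N (s *: u + (1 - s) *: v) = t *: N u + (1 - t) *: N v.
Proof.
move=> Ninj Nseg; suff le1 (u v : V) (s : R) : s <= 1 ->
    exists t : R, N (s *: u + (1 - s) *: v) = t *: N u + (1 - t) *: N v.
  move=> u v s; have [s1|s1] := leP s 1; first exact: le1.
  have [|t] := le1 v u (1 - s); first by lra.
  by rewrite subKr addrC => ->; exists (1 - t); rewrite subKr addrC.
move=> s1; have [s0|s0] := leP 0 s.
  by have [|t [_ ->]] := Nseg u v s; [rewrite s0 s1|exists t].
have [->|uv] := eqVneq u v.
  by exists 0; rewrite -!scalerDl !(addrC _ (1 - _)) !subrK !scale1r.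
have NuNv : N u != N v by apply: contra_neq uv => /Ninj.
(* Here [v] lies between [u] and [w], so [N v] is a combination of [N u] and
   [N w], in which injectivity makes the coefficient of [N w] nonzero. *)
set w := _ + _.
have vE : v = (- s / (1 - s)) *: u + (1 - (- s / (1 - s))) *: w.
  rewrite /w scalerDr !scalerA addrA -scalerDl.
  have -> : - s / (1 - s) + (1 - - s / (1 - s)) * s = 0 by field; lra.
  have -> : (1 - - s / (1 - s)) * (1 - s) = 1 by field; lra.
  by rewrite scale0r add0r scale1r.
have [|t [_]] := Nseg u w (- s / (1 - s)).
  by rewrite divr_ge0 ?ler_pdivrMr ?mul1r; lra.
rewrite -vE => Nv.
have t1 : 1 - t != 0.
  apply: contra_neq NuNv => t1; rewrite Nv t1 scale0r addr0.
  by rewrite (_ : t = 1) ?scale1r//; lra.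
exists (- t / (1 - t)).
rewrite {}Nv scalerDr !scalerA addrA -scalerDl.
have -> : - t / (1 - t) + (1 - - t / (1 - t)) * t = 0 by field.
have -> : (1 - - t / (1 - t)) * (1 - t) = 1 by field.
by rewrite scale0r add0r scale1r.
Qed.

Lemma segment_preserving_scale (R : realType) (V W : lmodType R) (N : V -> W) :
  injective N -> segment_preserving N -> N 0 = 0 ->
  forall u (s : R), exists t : R, N (s *: u) = t *: N u.
Proof.
move=> Ninj Nseg N0 u s.
have [t] := segment_preserving_line Ninj Nseg u 0 s.
by rewrite N0 !scaler0 !addr0 => ->; exists t.
Qed.

(** If [p] were not 1, the line through [N u] and [N (u + v)] would meet the line spanned by [N v].
    Pulled back by [N'], the common point would lie on both [u + Rv] and [Rv], making [u] a multiple
    of [v]. *)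
Lemma coef_add_parallel (R : realType) (V W : lmodType R)
    (N : V -> W) (N' : W -> V) :
  cancel N N' -> cancel N' N -> segment_preserving N' -> N 0 = 0 ->
  forall (u v : V) (p q : R), (forall c, u <> c *: v) ->
  N (u + v) = p *: N u + q *: N v -> p = 1.
Proof.
move=> NK N'K N'seg N0 u v p q uv Nuv; apply/eqP/negPn/negP => p1.
have p1' : 1 - p != 0 by rewrite subr_eq0 eq_sym.
have N'inj : injective N' by exact: can_inj N'K.
have N'0 : N' 0 = 0 by rewrite -N0 NK.
(* The weight [(1 - p)^-1] is the one that cancels the [N u] component. *)
have E : (1 - p)^-1 *: N (u + v) + (1 - (1 - p)^-1) *: N u
       = ((1 - p)^-1 * q) *: N v.
  rewrite Nuv scalerDr !scalerA addrAC -scalerDl.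
  have -> : (1 - p)^-1 * p + (1 - (1 - p)^-1) = 0 by field.
  by rewrite scale0r add0r.
have [s] := segment_preserving_line N'inj N'seg (N (u + v)) (N u) (1 - p)^-1.
have [t] := segment_preserving_scale N'inj N'seg N'0 (N v) ((1 - p)^-1 * q).
rewrite E !NK => -> uvE; apply: (uv (t - s)).
rewrite scalerBl uvE scalerDr (addrAC (s *: u)) -scalerDl [s + _]addrC.
by rewrite subrK scale1r addrK.
Qed.

Definition independent (R : realType) (V : lmodType R) (u v : V) :=
  u != 0 /\ forall c : R, v <> c *: u.

Lemma independent_sym (R : realType) (V : lmodType R) (u v : V) :
  independent u v -> independent v u.
Proof.
move=> [u0 vu]; split.
  by apply/eqP => v0; apply: (vu 0); rewrite scale0r.
move=> c uE; have c0 : c != 0.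
  by apply: contra_neq u0 => c0; rewrite uE c0 scale0r.
by apply: (vu c^-1); rewrite uE scalerA mulVf// scale1r.
Qed.

Lemma independent_scale (R : realType) (V : lmodType R) (u v : V) (c : R) :
  c != 0 -> independent u v -> independent (c *: u) v.
Proof.
move=> c0 [u0 vu]; split; first by rewrite scaler_eq0 negb_or c0.
by move=> d; rewrite scalerA; exact: vu.
Qed.

Lemma independent_shear (R : realType) (V : lmodType R) (u v : V) (c : R) :
  independent u v -> independent u (c *: u + v).
Proof.
move=> [u0 vu]; split=> // d /eqP; rewrite addrC -subr_eq0 -addrA -scalerBl.
by rewrite addr_eq0 -scaleNr => /eqP; exact: vu.
Qed.

Lemma segment_preserving_add_independent (R : realType) (V W : lmodType R)
    (N : V -> W) (N' : W -> V) :
  cancel N N' -> cancel N' N -> segment_preserving N ->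
  segment_preserving N' -> N 0 = 0 ->
  forall u v, independent u v -> N (u + v) = N u + N v.
Proof.
move=> NK N'K Nseg N'seg N0 u v uv.
have Ninj : injective N by exact: can_inj NK.
(* The sum [u + v] is the midpoint of [2 *: u] and [2 *: v], whose images are multiples of [N u] and
   [N v]. *)
have [p [q Nuv]] : exists p q, N (u + v) = p *: N u + q *: N v.
  have h2 : 0 <= (2^-1 : R) <= 1 by apply/andP; split; lra.
  have [t [_]] := Nseg (2 *: u) (2 *: v) 2^-1 h2.
  have -> : 1 - 2^-1 = 2^-1 :> R by field.
  rewrite !scalerA mulVf// !scale1r.
  have [a ->] := segment_preserving_scale Ninj Nseg N0 u 2.
  have [b ->] := segment_preserving_scale Ninj Nseg N0 v 2.
  by rewrite !scalerA => ->; exists (t * a), ((1 - t) * b).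
have [_ vu] := uv; have [_ uv'] := independent_sym uv.
have p1 := coef_add_parallel NK N'K N'seg N0 uv' Nuv.
move: (Nuv); rewrite [u + v]addrC [p *: _ + _]addrC => Nvu.
have q1 := coef_add_parallel NK N'K N'seg N0 vu Nvu.
by rewrite Nvu p1 q1 !scale1r addrC.
Qed.

Lemma segment_preserving_add (R : realType) (V W : lmodType R)
    (N : V -> W) (N' : W -> V) :
  (forall u : V, u != 0 -> exists v, independent u v) ->
  cancel N N' -> cancel N' N -> segment_preserving N ->
  segment_preserving N' -> N 0 = 0 ->
  forall u v, N (u + v) = N u + N v.
Proof.
move=> hV NK N'K Nseg N'seg N0 u v.
have Nadd := segment_preserving_add_independent NK N'K Nseg N'seg N0.
have [->|u0] := eqVneq u 0; first by rewrite N0 !add0r.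
have [[c vE]|uv] := pselect (exists c, v = c *: u); last first.
  by apply: Nadd; split=> // c vE; apply: uv; exists c.
have [v0|v0] := eqVneq v 0; first by rewrite v0 N0 !addr0.
have c0 : c != 0 by apply: contra_neq v0 => c0; rewrite vE c0 scale0r.
have [w uw] := hV u u0.
(* A vector outside the line reduces the collinear case to independent pairs:
   [N(u + v) + N w = N(u + v + w) = N u + N(v + w) = N u + N v + N w]. *)
apply: (addIr (N w)); rewrite -[RHS]addrA -(Nadd v w); last first.
  by rewrite vE; exact: independent_scale.
rewrite -(Nadd u (v + w)); last by rewrite vE; exact: independent_shear.
rewrite addrA vE -{1 3}[u]scale1r -scalerDl.
(* If [u + v] vanishes, the pair with [w] is not independent, but the identity is trivial. *)
have [->|c1] := eqVneq (1 + c) 0; first by rewrite scale0r N0 !add0r.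
by rewrite Nadd//; exact: independent_scale.
Qed.

(** * From additivity to affinity *)

Lemma segment_preserving_affine (R : realType) (V W : lmodType R)
    (M : V -> W) (M' : W -> V) :
  (forall u : V, u != 0 -> exists v, independent u v) ->
  cancel M M' -> cancel M' M -> segment_preserving M ->
  segment_preserving M' -> affine M.
Proof.
move=> hV MK M'K Mseg M'seg.
(* Translation makes the map fix the origin; by [comb], it commutes with affine combinations. *)
pose N u := M u - M 0; pose N' w := M' (w + M 0).
have NK : cancel N N' by move=> u; rewrite /N' /N subrK MK.
have N'K : cancel N' N by move=> w; rewrite /N' /N M'K addrK.
have comb (U : lmodType R) (t : R) (a b c : U) :
    t *: (a + c) + (1 - t) *: (b + c) = t *: a + (1 - t) *: b + c.
  by rewrite !scalerDr addrACA -scalerDl [t + _]addrC subrK scale1r.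
have Nseg : segment_preserving N.
  move=> u v s /(Mseg u v)[t [t01 E]]; exists t; split=> //.
  by rewrite /N E comb.
have N'seg : segment_preserving N'.
  move=> u v s /(M'seg (u + M 0) (v + M 0))[t [t01 E]]; exists t; split=> //.
  by rewrite /N' -E comb.
have N0 : N 0 = 0 by rewrite /N subrr.
have Nadd := segment_preserving_add hV NK N'K Nseg N'seg N0.
have Nmuln u n : N (u *+ n) = N u *+ n.
  by elim: n => [|n IH]; rewrite ?mulr0n ?N0// !mulrS Nadd IH.
have NZ01 (s : R) u : 0 <= s <= 1 ->
    exists t : R, 0 <= t <= 1 /\ N (s *: u) = t *: N u.
  move=> /(Nseg u 0)[t [t01]]; rewrite N0 !scaler0 !addr0 => E.
  by exists t.
have NZ (s : R) u : 0 <= s <= 1 -> N (s *: u) = s *: N u.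
  move=> s01; have [Nu0|Nu0] := eqVneq (N u) 0.
    by have [t [_ ->]] := NZ01 s u s01; rewrite Nu0 !scaler0.
  have [t [t01 tE]] := NZ01 s u s01.
  rewrite tE; congr (_ *: _).
  (* As N(n s u) is n t N(u) and also (m + c) N(u) with m the integral part of
     n s and c in [0, 1], the number n |t - s| is bounded independently of n. *)
  have bnd (n : nat) : n%:R * `|t - s| <= 1.
    have ns0 : 0 <= n%:R * s by rewrite mulr_ge0//; case/andP: s01.
    have [m [d [nsE d01]]] : exists (m : nat) (d : R),
        n%:R * s = m%:R + d /\ 0 <= d <= 1.
      exists (Num.truncn (n%:R * s)), (n%:R * s - (Num.truncn (n%:R * s))%:R).
      rewrite addrC subrK; split=> //.
      have /andP[] := truncn_itv ns0; rewrite -natr1 => ? ?.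
      by apply/andP; split; lra.
    have [t' [t'01 dE]] := NZ01 d u d01.
    have : (n%:R * t) *: N u = (m%:R + t') *: N u.
      rewrite -scalerA -tE scaler_nat -Nmuln -scaler_nat scalerA.
      by rewrite nsE !scalerDl Nadd !scaler_nat Nmuln dE.
    move=> /eqP; rewrite -subr_eq0 -scalerBl scaler_eq0 (negPf Nu0) orbF.
    rewrite subr_eq0 => /eqP ntE.
    rewrite -{1}(normr_nat R n) -normrM mulrBr ntE ler_norml.
    by apply/andP; split; lra.
  apply/eqP; rewrite -subr_eq0 -normr_eq0 eq_le normr_ge0 andbT leNgt.
  apply/negP => ts0.
  (* This integer exceeds the inverse of [|t - s|], so its product with [|t - s|] exceeds 1. *)
  have := bnd (Num.truncn `|t - s|^-1).+1; rewrite leNgt -ltr_pdivrMr// mul1r.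
  by rewrite truncnS_gt.
move=> u v s s01.
have M_N w : M w = N w + M 0 by rewrite /N subrK.
rewrite (M_N (_ + _)) (M_N u) (M_N v) comb Nadd !NZ//.
by apply/andP; split; lra.
Qed.

(** * Application to the dual space *)

Lemma dual_separates (R : realType) (X : normedModType R) (y : X) :
  y != 0 -> exists w : dual X, w y != 0.
Proof.
move=> y0.
have nsub : sublinear (fun x : X => `|x|).
  split=> [x z|t x t0]; first exact: ler_normD.
  by rewrite normrZ ger0_norm.
(* Domination by the norm at [x] and [- x] makes [f] continuous, while [f y] is the nonzero norm of
   [y]. *)
have [f [flin [fle fy]]] := Hahn_Banach y nsub.
pose fl : {linear X -> R^o} :=
  HB.pack f (GRing.isLinear.Build R X R^o *:%R f flin).
have fc : continuous fl.
  apply: bounded_linear_continuous; apply/linear_boundedP.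
  near=> r => x; have r1 : 1 <= r by near: r; apply: nbhs_pinfty_ge.
  apply: (@le_trans _ _ `|x|); last by rewrite ler_peMl.
  rewrite ler_norml fle andbT lerNl.
  by rewrite -(linearN fl) -normrN; exact: fle.
have fP : f \in @continuous_linear R X by apply/asboolP.
by exists (Dual fP); rewrite /= fy normr_eq0.
Unshelve. all: by end_near. Qed.

Lemma dualP (R : realType) (X : normedModType R) (u v : dual X) :
  u =1 v -> u = v.
Proof. by move=> uv; apply: val_inj; apply: funext. Qed.

Lemma dual_is_linear (R : realType) (X : normedModType R) (u : dual X) :
  linear u.
Proof. by case: u => u /= /asboolP[]. Qed.

(** In dimension at least 2 the kernel of [u] contains some [y != 0]. A functional that is nonzero
    at [y] cannot be a multiple of [u]. *)
Lemma dual_exists_independent (R : realType) (X : normedModType R)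
    (u : dual X) : dim_ge 2 X -> u != 0 -> exists v, independent u v.
Proof.
move=> [e efree] u0.
have [y [y0 uy]] : exists y, y != 0 /\ u y = 0.
  have ulin := dual_is_linear u.
  have u_0 : u 0 = 0.
    by have := ulin (-1) 0 0; rewrite scaler0 addr0 scaleN1r addNr.
  (* These coefficients make [u] vanish on the combination. Should the combination itself be zero,
     freeness gives [u (e ord0) = 0], and [e ord0] is the vector sought. *)
  pose a i : R := if i == ord0 :> 'I_2 then u (e ord_max) else - u (e ord0).
  have [ae0|ae0] := eqVneq (\sum_(i < 2) a i *: e i) 0.
    have ue : u (e ord0) = 0.
      by apply/eqP; rewrite -oppr_eq0; apply/eqP; exact: (efree a ae0 ord_max).
    exists (e ord0); split=> //; apply/eqP => e0.
    suff /(_ ord0)/eqP : forall i : 'I_2, (i == ord0)%:R = 0 :> R.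
      by rewrite oner_eq0.
    apply: efree; rewrite big_ord_recl e0 scaler0 add0r big1// => i _.
    by rewrite /= scale0r.
  exists (\sum_(i < 2) a i *: e i); split=> //.
  rewrite big_ord_recl big_ord1 ulin -[a _ *: e _]addr0 ulin u_0 addr0.
  have -> : lift ord0 ord0 = ord_max :> 'I_2 by apply: val_inj.
  by rewrite /a /= /GRing.scale /= mulNr mulrC subrr.
have [v vy] := dual_separates y0.
exists v; split=> // c vE; move: vy; rewrite vE.
by rewrite -[(c *: u) y]/(c * u y) uy mulr0 eqxx.
Qed.

(* Testing at [x] and [- x] puts [c x] between [a x] and [b x], so [c - b]
   vanishes on the kernel of [a - b]. *)
Lemma dual_segment (R : realType) (X : normedModType R) (a b c : dual X) :
  (forall x, c x <= Num.max (a x) (b x)) ->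
  exists t : R, 0 <= t <= 1 /\ c = t *: a + (1 - t) *: b.
Proof.
move=> cab.
have lin (u : dual X) (k : R) x z : u (k *: x + z) = k * u x + u z.
  exact: dual_is_linear.
have opp (u : dual X) x : u (- x) = - u x.
  have u0 : u 0 = 0 by have := lin u (-1) 0 0; rewrite scaler0 addr0; lra.
  by have := lin u (-1) x 0; rewrite scaleN1r addr0 u0 mulN1r addr0.
have cge x : Num.min (a x) (b x) <= c x.
  by rewrite -lerN2 oppr_min -!opp; exact: cab.
have combE (t : R) x :
    (t *: a + (1 - t) *: b) x = t * a x + (1 - t) * b x by [].
have cE x : a x = b x -> c x = b x.
  move=> E; apply: le_anti.
  by move: (cab x) (cge x); rewrite E maxxx minxx => -> ->.
have [[x0 ab0]|ab] := pselect (exists x0, a x0 <> b x0); last first.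
  exists 0; split; first by rewrite lexx ler01.
  apply: dualP => x; rewrite combE mul0r add0r subr0 mul1r; apply: cE.
  by apply: contra_notP ab => ab; exists x.
have d0 : a x0 - b x0 != 0 by rewrite subr_eq0; apply/eqP.
(* The value at [x0] determines [t]; the bounds on [c x0] put it in [[0, 1]]. *)
pose t := (c x0 - b x0) / (a x0 - b x0); exists t; split.
  have := cab x0; have := cge x0; rewrite /t.
  have [ab|ab|/ab0//] := ltgtP (a x0) (b x0) => ? ?.
    rewrite -[_ / _]mulrNN -invrN !opprB divr_ge0 ?ler_pdivrMr ?mul1r; lra.
  by rewrite divr_ge0 ?ler_pdivrMr ?mul1r; lra.
apply: dualP => x; rewrite combE.
(* This [k] makes [a] and [b] agree at [- k *: x0 + x], so [cE] applies there. *)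
pose k := (a x - b x) / (a x0 - b x0).
have := cE (- k *: x0 + x); rewrite !lin => h.
have {}h : - k * c x0 + c x = - k * b x0 + b x by apply: h; rewrite /k; field.
have -> : c x = k * (c x0 - b x0) + b x by lra.
by rewrite /k /t; field.
Qed.

Lemma quasiconvex_segment_preserving (R : realType) (X : normedModType R)
    (M : dual X -> dual X) :
  (forall x : X, quasiconvex (fun u : dual X => M u x)) ->
  segment_preserving M.
Proof. by move=> hM u v s s01; apply: dual_segment => x; exact: hM. Qed.

Theorem lemma2 (R : realType) (X : completeNormedModType R)
    (hdim : dim_ge 2 X)
    (M Minv : dual X -> dual X)
    (MK : cancel M Minv) (MinvK : cancel Minv M)
    (hM : forall x : X, quasiconvex (fun u : dual X => M u x))
    (hMinv : forall x : X, quasiconvex (fun u : dual X => Minv u x)) :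
  affine M.
Proof.
apply: (segment_preserving_affine _ MK MinvK).
- by move=> u; exact: dual_exists_independent.
- exact: quasiconvex_segment_preserving.
- exact: quasiconvex_segment_preserving.
Qed.
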